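(* Let $A$ be an $m\times n$ matrix over a field, with rank profile matrix $\mathcal{R}_A$. Then: (1) $\mathcal{R}_A$ is diagonal if and only if $A$ has generic rank profile; (2) $\mathcal{R}_A$ is a permutation matrix if and only if $A$ is invertible; (3) $\mathrm{RowRP}(A)=\mathrm{RowSupp}(\mathcal{R}_A)$ and $\mathrm{ColRP}(A)=\mathrm{ColSupp}(\mathcal{R}_A)$. Moreover, for all $1\le i\le m$ and $1\le j\le n$: (4) $\mathrm{RowRP}(A_{1..i,1..j})=\mathrm{RowSupp}((\mathcal{R}_A)_{1..i,1..j})$; (5) $\mathrm{ColRP}(A_{1..i,1..j})=\mathrm{ColSupp}((\mathcal{R}_A)_{1..i,1..j})$.
   Context: $M_{1..i,1..j}$ denotes the leading $i\times j$ sub-matrix of $M$. The row rank profile $\mathrm{RowRP}(A)$ (resp. column rank profile $\mathrm{ColRP}(A)$) of a matrix $A$ of rank $r$ is the lexicographically smallest sequence of $r$ indices of linearly independent rows (resp. columns) of $A$, identified with the set of its entries. An $m\times n$ matrix $A$ of rank $r$ has generic rank profile if its $r$ first leading principal minors are nonzero. $\mathrm{RowSupp}(M)$ (resp. $\mathrm{ColSupp}(M)$) is the set of indices of the nonzero rows (resp. columns) of $M$. An $r$-sub-permutation matrix is a matrix of rank $r$ with only $r$ nonzero entries, all equal to one. The rank profile matrix $\mathcal{R}_A$ of an $m\times n$ matrix $A$ of rank $r$ is the unique $m\times n$ $r$-sub-permutation matrix such that $\operatorname{rank}((\mathcal{R}_A)_{1..i,1..j})=\operatorname{rank}(A_{1..i,1..j})$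 for all $i,j$.
   Formalization: In (1), ''diagonal'' is read as diag(1,…,1,0,…,0), with the r ones in the first r diagonal positions; with plain ''diagonal'' the claim fails, e.g. for A = diag(0,1), where the rank profile matrix is A itself but the first leading principal minor is 0. *)

(* Defs.v *)
From HB Require Import structures.
From mathcomp Require Import all_boot all_order all_fingroup all_algebra.

Set Implicit Arguments.
Unset Strict Implicit.
Unset Printing Implicit Defensive.

Import Order.TTheory GRing.Theory.
Local Open Scope ring_scope.

(* M_{1..i,1..j}; the proofs of i <= m and j <= n are irrelevant. *)
Definition lead_submx (T : Type) m n i j (hi : (i <= m)%N) (hj : (j <= n)%N)
    (M : 'M[T]_(m, n)) : 'M[T]_(i, j) :=
  mxsub (widen_ord hi) (widen_ord hj) M.

Definition row_supp (F : fieldType) m n (M : 'M[F]_(m, n)) : {set 'I_m} :=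
  [set i | row i M != 0].

Definition col_supp (F : fieldType) m n (M : 'M[F]_(m, n)) : {set 'I_n} :=
  [set j | col j M != 0].

(* Sequences of \rank A row indices are compared in the lexicographic order
   carried by tuplelexi; they are not required to be increasing.  The default
   value of the arg min is an actual sequence of independent rows, see
   row_rp_seqP. *)
Definition row_rp_seq (F : fieldType) m n (A : 'M[F]_(m, n)) :
    (\rank A).-tuplelexi 'I_m :=
  [arg min_(t < [tuple maxrankfun A k | k < \rank A]
              : (\rank A).-tuplelexi 'I_m
            | row_free (rowsub (tnth t) A)) t]%O.

Definition row_rp (F : fieldType) m n (A : 'M[F]_(m, n)) : {set 'I_m} :=
  [set i in row_rp_seq A].

Definition col_rp (F : fieldType) m n (A : 'M[F]_(m, n)) : {set 'I_n} :=
  row_rp A^T.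

Definition generic_rank_profile (F : fieldType) m n (A : 'M[F]_(m, n)) : Prop :=
  forall k (hm : (k <= m)%N) (hn : (k <= n)%N),
    (0 < k <= \rank A)%N -> \det (lead_submx hm hn A) != 0.

Definition is_sub_perm_mx (F : fieldType) m n r (M : 'M[F]_(m, n)) : bool :=
  [&& \rank M == r,
      #|[set ij : 'I_m * 'I_n | M ij.1 ij.2 != 0]| == r
    & [forall i, forall j, (M i j != 0) ==> (M i j == 1)]].

Definition is_rank_profile_mx (F : fieldType) m n (A R : 'M[F]_(m, n)) : bool :=
  is_sub_perm_mx (\rank A) R
  && [forall i : 'I_m, forall j : 'I_n,
        \rank (lead_submx (ltn_ord i) (ltn_ord j) R)
        == \rank (lead_submx (ltn_ord i) (ltn_ord j) A)].

(* For r-sub-permutation matrices, "diagonal" means diag(1, ..., 1, 0, ..., 0):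
   the nonzero entries occupy the first r = \rank M diagonal positions.  Without
   this condition A = diag(0, 1) = R_A would be diagonal although A does not
   have generic rank profile. *)
Definition is_lead_diag_mx (F : fieldType) m n (M : 'M[F]_(m, n)) : Prop :=
  is_diag_mx M /\
  forall (i : 'I_m) (j : 'I_n), i = j :> nat -> (M i j != 0) = (i < \rank M)%N.

(* A rectangular matrix is a permutation matrix (resp. invertible) when it is
   square and is so as a square matrix. *)
Definition permutation_mx (F : fieldType) m n (M : 'M[F]_(m, n)) : Prop :=
  exists e : n = m, is_perm_mx (castmx (erefl m, e) M).

Definition invertible_mx (F : fieldType) m n (M : 'M[F]_(m, n)) : Prop :=
  exists e : n = m, castmx (erefl m, e) M \in unitmx.

Lemma row_rp_seqP (F : fieldType) m n (A : 'M[F]_(m, n)) :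
  row_free (rowsub (tnth (row_rp_seq A)) A) /\
  forall t : (\rank A).-tuplelexi 'I_m,
    row_free (rowsub (tnth t) A) -> (row_rp_seq A <= t)%O.
Proof.
rewrite /row_rp_seq; case: Order.TotalTheory.arg_minP => [|t tf tmin].
  have -> : rowsub (tnth [tuple maxrankfun A k | k < \rank A]) A
            = rowsub (maxrankfun A) A.
    by apply/matrixP=> i j; rewrite !mxE tnth_mktuple.
  exact: maxrowsub_free.
by split=> // u; apply: tmin.
Qed.

Section RankProfileMatrix.
Variable F : fieldType.

Let supp_rows m n (c : 'I_m -> 'I_n -> bool) := [set k | [exists l, c k l]].

Let sum_ge_supp m n (c : 'I_m -> 'I_n -> bool) k :
  ((k \in supp_rows c) <= \sum_l c k l)%N.
Proof.
rewrite inE; case: existsP => [[l ckl]|//].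
by rewrite (bigD1 l) //= ckl leq_addr.
Qed.

Let rank_le_supp m n (M : 'M[F]_(m, n)) :
  (\rank M <= #|supp_rows (fun k l => (M k l != 0)%R)|)%N.
Proof.
set S := supp_rows _.
have sub : (M <= rowsub (@enum_val _ (mem S)) M)%MS.
  apply/row_subP=> k; have [kS|kS] := boolP (k \in S).
    rewrite (_ : row k M = row (enum_rank_in kS k) (rowsub (@enum_val _ (mem S)) M)).
      exact: row_sub.
    by apply/rowP=> l; rewrite !mxE enum_rankK_in.
  suff -> : row k M = 0 by exact: sub0mx.
  apply/rowP=> l; rewrite !mxE; apply/eqP/negPn.
  by apply: contra kS => Mkl; rewrite inE; apply/existsP; exists l.
by apply: leq_trans (mxrankS sub) (rank_leq_row _).
Qed.

Let rank_partial_perm m n (M : 'M[F]_(m, n)) (c : 'I_m -> 'I_n -> bool) :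
  (forall k l, M k l = (c k l)%:R) ->
  (forall k, (\sum_l c k l <= 1)%N) -> (forall l, (\sum_k c k l <= 1)%N) ->
  \rank M = (\sum_k \sum_l c k l)%N.
Proof.
move=> Mc c_row c_col; set S := supp_rows c.
have eS : supp_rows (fun k l => M k l != 0) = S.
  apply/setP=> k; rewrite !inE; apply: eq_existsb => l.
  by rewrite Mc; case: (c k l); rewrite ?oner_eq0 ?eqxx.
have eqS k : (\sum_l c k l)%N = (k \in S).
  apply/eqP; rewrite eqn_leq sum_ge_supp andbT.
  case kS: (k \in S); first exact: c_row.
  rewrite big1 // => l _; case ckl: (c k l) => //.
  by move: kS; rewrite inE; move/existsP; case; exists l.
rewrite (eq_bigr _ (fun k _ => eqS k)).
rewrite -big_mkcond sum1_card.
apply/eqP; rewrite eqn_leq -{1}eS rank_le_supp /=.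
set f := @enum_val _ (mem S).
have fM : rowsub f M *m (rowsub f M)^T = 1%:M.
  apply/matrixP=> a b; rewrite !mxE.
  have /existsP[l0 cl0] : [exists l, c (f a) l].
    by have := enum_valP a; rewrite -/(f a) inE.
  rewrite (bigD1 l0) //= !mxE !Mc cl0 mul1r big1 ?addr0.
    have [<-|nab] := eqVneq a b; first by rewrite cl0.
    case cb : (c (f b) l0) => //.
    have nf : f b != f a by rewrite (inj_eq enum_val_inj) eq_sym.
    have := c_col l0; rewrite (bigD1 (f a)) //= (bigD1 (f b)) //= cl0 cb.
    by rewrite addnA.
  move=> l nl; rewrite !mxE !Mc; case cl : (c (f a) l); last by rewrite mul0r.
  have := c_row (f a); rewrite (bigD1 l0) //= (bigD1 l) //= cl0 cl.
  by rewrite addnA.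
have : row_free (rowsub f M) by apply/row_freeP; exists (rowsub f M)^T.
by rewrite /row_free => /eqP <-; apply: mxrankS; apply: rowsub_sub.
Qed.

Let lead_pid m n (A : 'M[F]_(m, n)) i j (hi : (i <= m)%N) (hj : (j <= n)%N) :
  \rank (lead_submx hi hj A)
  = \rank ((pid_mx i : 'M_m) *m A *m (pid_mx j : 'M_n)).
Proof.
have -> : lead_submx hi hj A
          = (pid_mx i : 'M_(i, m)) *m A *m (pid_mx j : 'M_(n, j)).
  apply/matrixP=> a b; rewrite !mxE (bigD1 (widen_ord hj b)) //= big1.
    rewrite addr0 !mxE (bigD1 (widen_ord hi a)) //= big1.
      by rewrite addr0 !mxE /= !eqxx !ltn_ord mul1r mulr1.
    move=> k nk; rewrite !mxE (_ : (a == k :> nat) = false) ?mul0r //.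
    by apply/negP=> /eqP ak; case/eqP: nk; apply/val_inj.
  move=> k nk; rewrite !mxE (_ : (k == b :> nat) = false) ?mulr0 //.
  by apply/negP=> /eqP ak; case/eqP: nk; apply/val_inj.
apply/eqP; rewrite eqn_leq; apply/andP; split.
  have -> : (pid_mx i : 'M_(i, m)) *m A *m (pid_mx j : 'M_(n, j))
    = (pid_mx i : 'M_(i, m)) *m ((pid_mx i : 'M_m) *m A *m (pid_mx j : 'M_n))
        *m (pid_mx j : 'M_(n, j)).
    rewrite !mulmxA mul_pid_mx !minnn (minn_idPr hi) -!mulmxA mul_pid_mx.
    by rewrite !minnn (minn_idPr hj).
  by apply: leq_trans (mxrankM_maxl _ _) (mxrankM_maxr _ _).
have -> : (pid_mx i : 'M_m) *m A *m (pid_mx j : 'M_n)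
    = (pid_mx i : 'M_(m, i)) *m
        ((pid_mx i : 'M_(i, m)) *m A *m (pid_mx j : 'M_(n, j)))
        *m (pid_mx j : 'M_(j, n)).
  rewrite !mulmxA mul_pid_mx !minnn -!mulmxA mul_pid_mx.
  by rewrite !minnn.
by apply: leq_trans (mxrankM_maxl _ _) (mxrankM_maxr _ _).
Qed.

Section Existence.
Variables (m n : nat) (A : 'M[F]_(m, n)).

Let P p i : 'M[F]_p := pid_mx i.
Let B i j := P m i *m A *m P n j.
Let rk i j : nat := \rank (B i j).
Let d (i : 'I_m) j := ~~ (row i A *m P n j <= B i j)%MS.

Let pid_ge p i : (p <= i)%N -> P p i = 1%:M.
Proof.
move=> le_pi; rewrite -pid_mx_1; apply/matrixP=> a b; rewrite !mxE.
by rewrite ltn_ord (leq_trans (ltn_ord a) le_pi).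
Qed.

Let P0 p : P p 0 = 0.
Proof. exact: pid_mx_0. Qed.

Let PM p i j : P p i *m P p j = P p (minn i j).
Proof.
rewrite /P mul_pid_mx; apply/matrixP=> a b; rewrite !mxE !leq_min ltn_ord.
by rewrite /= andbC.
Qed.

Let PS p (i : 'I_p) : P p i.+1 = P p i + delta_mx i i.
Proof.
apply/matrixP=> a b; rewrite !mxE ltnS leq_eqVlt -!val_eqE /=.
have [ab|nab] /= := eqVneq (a : nat) b.
  by rewrite -ab; case: (ltngtP a i); rewrite ?addr0 ?add0r.
by case: eqP => [<-|_]; rewrite ?[_ == a :> nat]eq_sym ?(negPf nab) addr0.
Qed.

Let delta_row p q (i : 'I_p) (M : 'M[F]_(p, q)) :
  delta_mx i i *m M = delta_mx i ord0 *m row i M.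
Proof. by rewrite rowE mulmxA mul_delta_mx. Qed.

Let rkS (i : 'I_m) j : rk i.+1 j = (rk i j + d i j)%N.
Proof.
have eB : (B i.+1 j :=: B i j + row i A *m P n j)%MS.
  apply/eqmxP/andP; split.
    rewrite /B PS mulmxDl mulmxDl delta_row.
    apply: addmx_sub_adds => //; rewrite -!mulmxA; exact: submxMl.
  rewrite addsmx_sub; apply/andP; split.
    have -> : B i j = P m i *m B i.+1 j.
      by rewrite /B !mulmxA PM (minn_idPl (leqnSn i)).
    exact: submxMl.
  have -> : row i A *m P n j = delta_mx 0 i *m B i.+1 j.
    rewrite /B !mulmxA (_ : delta_mx 0 i *m P m i.+1 = delta_mx 0 i) -?rowE //.
    apply/rowP=> b; rewrite !mxE eqxx ltnSn andbT /=.
    by rewrite eq_sym.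
  exact: submxMl.
rewrite /rk eB /d; case: (boolP (_ <= _)%MS) => /= sub.
  by rewrite addn0 (addsmx_idPl sub).
apply/eqP; rewrite eqn_leq; apply/andP; split.
  apply: leq_trans (mxrank_adds_leqif _ _) _.
  by rewrite leq_add2l rank_leq_row.
rewrite addn1 (ltn_leqif (mxrank_leqif_sup (addsmxSl _ _))).
by rewrite addsmx_sub negb_and sub orbT.
Qed.

Let rk0l j : rk 0 j = 0%N.
Proof. by rewrite /rk /B P0 !mul0mx mxrank0. Qed.

Let d0 i : d i 0 = false.
Proof. by rewrite /d P0 mulmx0 sub0mx. Qed.

Let dS i j : d i j -> d i j.+1.
Proof.
apply: contra => /(submxMr (P n j)).
by rewrite /B -!mulmxA PM (minn_idPr (leqnSn j)).
Qed.

Let c (i : 'I_m) j := d i j.+1 && ~~ d i j.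

Let sum_c i j : (\sum_(l < j) c i l)%N = d i j.
Proof.
elim: j => [|j IH]; first by rewrite big_ord0 d0.
rewrite big_ord_recr IH /= /c; have := @dS i j.
by case: (d i j) => [->|_] //; case: (d i j.+1).
Qed.

Let sum_d i (hi : (i <= m)%N) j : (\sum_(k < i) d (widen_ord hi k) j)%N = rk i j.
Proof.
elim: i hi => [|i IH] hi; first by rewrite big_ord0 rk0l.
rewrite big_ord_recr /= (_ : widen_ord hi ord_max = Ordinal hi); last exact/val_inj.
rewrite (rkS (Ordinal hi)) /= -(IH (ltnW hi)); congr (_ + _)%N.
by apply: eq_bigr => k _; congr (d _ _ : nat); apply/val_inj.
Qed.

Let sum_cc i j (hi : (i <= m)%N) :
  (\sum_(k < i) \sum_(l < j) c (widen_ord hi k) l)%N = rk i j.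
Proof. by rewrite -(sum_d hi); apply: eq_bigr => k _; rewrite sum_c. Qed.

Let sum_ccol i (hi : (i <= m)%N) (j : 'I_n) :
  (\sum_(k < i) c (widen_ord hi k) j <= 1)%N.
Proof.
rewrite -(leq_add2l (rk i j)) -(sum_cc j hi) -big_split /=.
under eq_bigr => k _ do rewrite -(big_ord_recr j (fun l => nat_of_bool (c _ l))).
rewrite !sum_cc /rk {1}/B PS mulmxDr.
apply: leq_trans (mxrank_add _ _) _; rewrite leq_add2l.
rewrite (_ : delta_mx j j = delta_mx j (0 : 'I_1) *m delta_mx 0 j).
  by rewrite mulmxA; apply: leq_trans (mxrankM_maxr _ _) (rank_leq_row _).
by rewrite mul_delta_mx.
Qed.

Let R : 'M[F]_(m, n) := \matrix_(i, j) (c i j)%:R.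

Let rank_lead_R i j (hi : (i <= m)%N) (hj : (j <= n)%N) :
  \rank (lead_submx hi hj R) = rk i j.
Proof.
rewrite (@rank_partial_perm _ _ _ (fun k l => c (widen_ord hi k) l)).
- exact: sum_cc.
- by move=> k l; rewrite !mxE.
- by move=> k; rewrite sum_c; case: (d _ _).
by move=> l; apply: (sum_ccol hi (widen_ord hj l)).
Qed.

Let lead_full (M : 'M[F]_(m, n)) : lead_submx (leqnn m) (leqnn n) M = M.
Proof. by apply/matrixP=> a b; rewrite !mxE; congr (M _ _); apply/val_inj. Qed.

Lemma rank_profile_mx_exists : exists R, is_rank_profile_mx A R.
Proof.
exists R; have rkA : rk m n = \rank A.
  by rewrite /rk /B !pid_ge // mul1mx mulmx1.
apply/andP; split; last first.
  apply/forallP=> i; apply/forallP=> j.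
  by rewrite rank_lead_R lead_pid.
apply/and3P; split.
- by rewrite -{1}[R]lead_full rank_lead_R rkA.
- rewrite -rkA -(sum_cc n (leqnn m)) pair_big /= -sum1_card big_mkcond /=.
  apply/eqP/eq_bigr => -[k l] _ /=; rewrite inE /= mxE.
  rewrite (_ : widen_ord _ k = k); last exact/val_inj.
  by case: (c k l); rewrite ?oner_eq0 ?eqxx.
apply/forallP=> i; apply/forallP=> j; rewrite mxE.
by case: (c i j); rewrite ?oner_eq0 ?eqxx.
Qed.

End Existence.

Let sub_perm_row m n r (M : 'M[F]_(m, n)) k : is_sub_perm_mx r M ->
  (\sum_l (M k l != 0)%R <= 1)%N.
Proof.
case/and3P=> /eqP rM /eqP cM _; set S := supp_rows (fun k l => M k l != 0).
have cE : (\sum_k \sum_l (M k l != 0)%R)%N = r.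
  rewrite -cM pair_big /= -sum1_card [RHS]big_mkcond /=.
  by apply: eq_bigr => -[a b] _; rewrite inE /=; case: (M a b == 0).
have leS : (\sum_k \sum_l (M k l != 0)%R <= \sum_k (k \in S))%N.
  rewrite cE -rM -(big_mkcond (mem S) (fun=> 1%N)) sum1_card; exact: rank_le_supp.
rewrite leqNgt; apply/negP=> gt1; move: leS; rewrite leqNgt => /negP; apply.
rewrite (bigD1 k) //= [ltnRHS](bigD1 k) //= -addSn leq_add //.
  by apply: leq_trans gt1; case: (k \in S).
by apply: leq_sum => a _; apply: (@sum_ge_supp _ _ (fun k l => M k l != 0)).
Qed.

Let sub_perm_tr m n r (M : 'M[F]_(m, n)) :
  is_sub_perm_mx r M -> is_sub_perm_mx r M^T.
Proof.
case/and3P=> rM /eqP cM eM; apply/and3P; split; first by rewrite mxrank_tr.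
  rewrite -cM -(card_imset _ (can_inj (@swap_pairK _ _))) /=.
  apply/eqP; congr #|pred_of_set _|; apply/setP=> -[a b]; rewrite !inE /=.
  apply/imsetP/idP => [[[u v]]|ab].
    by rewrite !inE /= mxE => ? [-> ->].
  by exists (b, a); rewrite // !inE /= mxE.
by apply/forallP=> i; apply/forallP=> j; rewrite mxE; apply: (forallP (forallP eM j)).
Qed.

Let sub_perm_lead m n r (M : 'M[F]_(m, n)) i j (hi : (i <= m)%N) (hj : (j <= n)%N) :
  is_sub_perm_mx r M ->
  \rank (lead_submx hi hj M)
  = (\sum_(k < i) \sum_(l < j) (M (widen_ord hi k) (widen_ord hj l) != 0)%R)%N.
Proof.
have wle p q (h : (p <= q)%N) (f : 'I_q -> nat) :
    (\sum_(a < p) f (widen_ord h a) <= \sum_a f a)%N.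
  pose g a := (if insub a is Some a' then f a' else 0)%N.
  have gE (a : 'I_q) : f a = g a by rewrite /g valK.
  rewrite (eq_bigr (fun a : 'I_p => g a)) => [|a _]; last by rewrite gE.
  rewrite [leqRHS](eq_bigr (fun a : 'I_q => g a)) => [|a _]; last by rewrite gE.
  rewrite (big_ord_widen q g h) [leqLHS]big_mkcond.
  by apply: leq_sum => a _; case: ifP.
move=> Msp; apply: rank_partial_perm => [k l|k|l].
- rewrite !mxE; case/and3P: Msp => _ _ /forallP/(_ (widen_ord hi k))/forallP.
  by move/(_ (widen_ord hj l)); case: eqP => [->|_ /eqP->].
- apply: leq_trans (sub_perm_row (widen_ord hi k) Msp).
  exact: (wle _ _ hj (fun l => nat_of_bool (M (widen_ord hi k) l != 0))).
apply: leq_trans (_ : \sum_k (M k (widen_ord hj l) != 0)%R <= _)%N.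
  exact: (wle _ _ hi (fun k => nat_of_bool (M k (widen_ord hj l) != 0))).
have := sub_perm_row (widen_ord hj l) (sub_perm_tr Msp).
by under eq_bigr => k _ do rewrite mxE.
Qed.

Lemma rank_profile_mx_unique m n (A R R' : 'M[F]_(m, n)) :
  is_rank_profile_mx A R -> is_rank_profile_mx A R' -> R = R'.
Proof.
case/andP=> Rsp Rrk /andP[Rsp' Rrk'].
pose g (M : 'M[F]_(m, n)) k l : nat :=
  if (insub k, insub l) is (Some k', Some l') then (M k' l' != 0)%R else false.
pose s M i j := (\sum_(k < i) \sum_(l < j) g M k l)%N.
have gE M i j (hi : (i <= m)%N) (hj : (j <= n)%N) :
    is_sub_perm_mx (\rank A) M -> \rank (lead_submx hi hj M) = s M i j.
  move=> Msp; rewrite (sub_perm_lead hi hj Msp) /s.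
  apply: eq_bigr => k _; apply: eq_bigr => l _.
  rewrite /g -[nat_of_ord k]/(val (widen_ord hi k)).
  by rewrite -[nat_of_ord l]/(val (widen_ord hj l)) !valK.
have sE i j : (i <= m)%N -> (j <= n)%N -> s R i j = s R' i j.
  case: i => [|i] hi; first by rewrite /s !big_ord0.
  case: j => [|j] hj; first by rewrite /s !big1 // => k _; rewrite big_ord0.
  rewrite -!(gE _ _ _ hi hj) //.
  have /forallP/(_ (Ordinal hj))/eqP e1 := forallP Rrk (Ordinal hi).
  have /forallP/(_ (Ordinal hj))/eqP e2 := forallP Rrk' (Ordinal hi).
  move: e1 e2; rewrite (bool_irrelevance (ltn_ord (Ordinal hi)) hi).
  by rewrite (bool_irrelevance (ltn_ord (Ordinal hj)) hj) => -> ->.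
have rowE M i j : s M i.+1 j = (s M i j + \sum_(l < j) g M i l)%N.
  by rewrite /s big_ord_recr.
have gRR (i : 'I_m) (j : 'I_n) : g R i j = g R' i j.
  have t h : (h <= n)%N -> (\sum_(l < h) g R i l = \sum_(l < h) g R' i l)%N.
    move=> hn; apply/eqP; rewrite -(eqn_add2l (s R i h)) -rowE.
    by rewrite [s R i h]sE ?(ltnW (ltn_ord i)) // -rowE sE.
  have := t j.+1 (ltn_ord j); rewrite !big_ord_recr /= t ?(ltnW (ltn_ord j)) //.
  exact: addnI.
apply/matrixP=> i j; have := gRR i j; rewrite /g !valK.
case/and3P: Rsp => _ _ /forallP/(_ i)/forallP/(_ j)/implyP R1.
case/and3P: Rsp' => _ _ /forallP/(_ i)/forallP/(_ j)/implyP R1'.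
have [->|/R1/eqP->] := eqVneq (R i j) 0;
  by have [->|/R1'/eqP->] := eqVneq (R' i j) 0.
Qed.

End RankProfileMatrix.

Definition rank_profile_mx (F : fieldType) m n (A : 'M[F]_(m, n)) : 'M[F]_(m, n) :=
  xchoose (rank_profile_mx_exists A).

Lemma rank_profile_mxP (F : fieldType) m n (A : 'M[F]_(m, n)) :
  is_rank_profile_mx A (rank_profile_mx A).
Proof. exact: xchooseP. Qed.

(* Main.v *)
(* Write the lexicographically smallest independent rows as B and A = U B.  An
   exchange argument shows that column k of U vanishes above the k-th selected
   index, while the selected rows of U are unit vectors.  Hence row i is
   selected iff it is not in the span of the rows above it, i.e. iff the rank of
   the leading submatrices jumps at i.  These jumps are the same for A and R_A,
   and for R_A, which has at most one nonzero entry per column, they occur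
   exactly at the nonzero rows.  Columns follow by transposition, (1) and (2)
   from the equality of ranks of leading submatrices. *)

Require Import Defs.
From mathcomp Require Import all_boot all_order all_fingroup all_algebra.

Local Open Scope ring_scope.

Set Implicit Arguments.
Unset Strict Implicit.
Unset Printing Implicit Defensive.
Import Order.TTheory GRing.Theory.

(** * Leading submatrices, supports and sub-permutation matrices *)

Lemma lead_submx_irr (T : Type) m n i j (hi hi' : (i <= m)%N)
    (hj hj' : (j <= n)%N) (M : 'M[T]_(m, n)) :
  lead_submx hi hj M = lead_submx hi' hj' M.
Proof. by rewrite (bool_irrelevance hi hi') (bool_irrelevance hj hj'). Qed.

Lemma lead_submx_lead (T : Type) m n i j i' j' (hi : (i <= m)%N)
    (hj : (j <= n)%N) (hi' : (i' <= i)%N) (hj' : (j' <= j)%N)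
    (M : 'M[T]_(m, n)) :
  lead_submx hi' hj' (lead_submx hi hj M)
  = lead_submx (leq_trans hi' hi) (leq_trans hj' hj) M.
Proof. by apply/matrixP=> a b; rewrite !mxE; congr (M _ _); apply: val_inj. Qed.

Lemma tr_lead_submx (T : Type) m n i j (hi : (i <= m)%N) (hj : (j <= n)%N)
    (M : 'M[T]_(m, n)) :
  (lead_submx hi hj M)^T = lead_submx hj hi M^T.
Proof. by apply/matrixP=> a b; rewrite !mxE. Qed.

Lemma col_supp_tr (F : fieldType) m n (M : 'M[F]_(m, n)) :
  col_supp M = row_supp M^T.
Proof. by apply/setP=> j; rewrite !inE -tr_col trmx_eq0. Qed.

Lemma row_suppP (F : fieldType) m n (M : 'M[F]_(m, n)) i :
  reflect (exists j, M i j != 0) (i \in row_supp M).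
Proof.
rewrite inE; apply: (iffP (rV0Pn _)) => -[j]; first by rewrite mxE; exists j.
by move=> Mij; exists j; rewrite mxE.
Qed.

Lemma mxrank_le_row_supp (F : fieldType) m n (M : 'M[F]_(m, n)) :
  (\rank M <= #|row_supp M|)%N.
Proof.
have sub : (M <= \sum_(i in row_supp M) <<row i M>>)%MS.
  apply/row_subP=> i; have [iS|] := boolP (i \in row_supp M).
    by apply: (sumsmx_sup i); rewrite ?genmxE.
  by rewrite inE negbK => /eqP->; apply: sub0mx.
apply: leq_trans (mxrankS sub) _; apply: leq_trans (mxrank_sum_leqif _) _.
by rewrite -sum1_card; apply: leq_sum => i _; rewrite /= mxrank_gen rank_leq_row.
Qed.

(** Unlike [is_sub_perm_mx r], this passes to leading submatrices without a rank to track; the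
    condition on rows is the same predicate for the transpose. *)
Definition col_partial_perm (F : fieldType) m n (M : 'M[F]_(m, n)) : Prop :=
  forall i i' j, M i j != 0 -> M i' j != 0 -> i = i'.

(** The [r] nonzero positions project onto the row support, which has at least [\rank M = r]
    elements, so the projection is injective. *)
Lemma sub_perm_row_uniq (F : fieldType) m n r (M : 'M[F]_(m, n)) :
  is_sub_perm_mx r M -> col_partial_perm M^T.
Proof.
case/and3P=> /eqP rM /eqP cM _ j j' i; rewrite !mxE => Mij Mij'.
set S := [set ij | _] in cM.
have supE : row_supp M = fst @: S.
  apply/setP=> a; apply/row_suppP/imsetP => [[b Mab]|[[a' b] + ->]].
    by exists (a, b); rewrite ?inE.
  by rewrite inE; exists b.
have /imset_injP injS : #|fst @: S| == #|S|.
  by rewrite eqn_leq leq_imset_card cM -rM -supE mxrank_le_row_supp.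
suff [] : (i, j) = (i, j') by [].
by apply: injS; rewrite ?inE.
Qed.

Lemma sub_perm_col_uniq (F : fieldType) m n r (M : 'M[F]_(m, n)) :
  is_sub_perm_mx r M -> col_partial_perm M.
Proof.
case/and3P=> /eqP rM /eqP cM _ i i' j Mij Mij'.
set S := [set ij | _] in cM.
have supE : row_supp M^T = snd @: S.
  apply/setP=> b; apply/row_suppP/imsetP => [[a]|[[a b'] + ->]].
    by rewrite mxE => Mab; exists (a, b); rewrite ?inE.
  by rewrite inE; exists a; rewrite mxE.
have /imset_injP injS : #|snd @: S| == #|S|.
  by rewrite eqn_leq leq_imset_card cM -rM -supE -mxrank_tr mxrank_le_row_supp.
suff [] : (i, j) = (i', j) by [].
by apply: injS; rewrite ?inE.
Qed.

(** Turns membership in a span into an equality of ranks, the only data that [A] and its rank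
    profile matrix share. *)
Lemma row_sub_lead (F : fieldType) m n (A : 'M[F]_(m, n)) (i : 'I_m) :
  (row i A <= lead_submx (ltnW (ltn_ord i)) (leqnn n) A)%MS
  = (\rank (lead_submx (ltnW (ltn_ord i)) (leqnn n) A)
     == \rank (lead_submx (ltn_ord i) (leqnn n) A)).
Proof.
have rowE k (hk : (k <= m)%N) (a : 'I_k) :
    row a (lead_submx hk (leqnn n) A) = row (widen_ord hk a) A.
  by apply/rowP=> b; rewrite !mxE; congr (A _ _); apply: val_inj.
have le_lead : (lead_submx (ltnW (ltn_ord i)) (leqnn n) A
                <= lead_submx (ltn_ord i) (leqnn n) A)%MS.
  apply/row_subP=> a; rewrite rowE.
  rewrite (_ : widen_ord _ a = widen_ord (ltn_ord i) (widen_ord (leqnSn i) a)).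
    by rewrite -rowE row_sub.
  exact: val_inj.
rewrite (mxrank_leqif_sup le_lead).2; apply/idP/row_subP => [iA a|/(_ ord_max)].
  rewrite rowE; have [ai|nai] := ltnP a i.
    by rewrite (_ : widen_ord _ a = widen_ord (ltnW (ltn_ord i)) (Ordinal ai));
      [rewrite -rowE row_sub | apply: val_inj].
  rewrite (_ : widen_ord _ a = i) //; apply/val_inj/eqP.
  by rewrite eqn_leq nai andbT -ltnS; apply: (ltn_ord a).
by rewrite rowE (_ : widen_ord _ _ = i) //; apply: val_inj.
Qed.

(** * Coordinates in the lexicographically smallest independent rows *)

Section RowRankProfile.
Variables (F : fieldType) (m n : nat) (A : 'M[F]_(m, n)).

Let t := row_rp_seq A.
Let B := rowsub (tnth t) A.
Let U := A *m pinvmx B.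

Let freeB : row_free B. Proof. exact: (row_rp_seqP A).1. Qed.

Let AE : A = U *m B.
Proof.
rewrite mulmxKpV //; suff /eqmxP : (B == A)%MS by move->.
by rewrite -(mxrank_leqif_eq (rowsub_sub _ _)) (eqP freeB).
Qed.

Let coord_row_rp_seq k : row (tnth t k) U = delta_mx 0 k.
Proof.
apply: (row_free_inj freeB); rewrite -row_mul -AE -rowE.
by apply/rowP=> b; rewrite !mxE.
Qed.

(* Exchange: otherwise replacing the k-th index by i would give a
   lexicographically smaller independent sequence. *)
Let coord_eq0 (i : 'I_m) k : (i < tnth t k)%N -> U i k = 0.
Proof.
move=> lt_i; apply/eqP/negPn/negP => Uik.
(* [t'] need not be increasing, since the minimum is taken over all sequences. *)
pose t' : (\rank A).-tuplelexi 'I_m :=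
  [tuple if l == k then i else tnth t l | l < \rank A].
have t'E l : tnth t' l = if l == k then i else tnth t l by rewrite tnth_mktuple.
have Brow l : l != k -> (row l B <= rowsub (tnth t') A)%MS.
  move=> lk; rewrite (_ : row l B = row l (rowsub (tnth t') A)) ?row_sub //.
  by apply/rowP=> b; rewrite !mxE t'E (negPf lk).
have sub : (B <= rowsub (tnth t') A)%MS.
  apply/row_subP=> l; have [->|/Brow//] := eqVneq l k.
  have iE : row i A = U i k *: row k B + \sum_(l | l != k) U i l *: row l B.
    rewrite {1}AE row_mul mulmx_sum_row (bigD1 k) //= mxE; congr (_ + _).
    by apply: eq_bigr => a _; rewrite mxE.
  (* The expansion of row [i] is solved for row [k] of [B], so the exchange loses no rank. *)
  have -> : row k B = (U i k)^-1 *: (row i A - \sum_(l | l != k) U i l *: row l B).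
    by rewrite iE addrK scalerA mulVf // scale1r.
  apply/scalemx_sub/addmx_sub.
    rewrite (_ : row i A = row k (rowsub (tnth t') A)) ?row_sub //.
    by apply/rowP=> b; rewrite !mxE t'E eqxx.
  by rewrite eqmx_opp; apply: summx_sub => a ak; apply/scalemx_sub/Brow.
have free' : row_free (rowsub (tnth t') A).
  by rewrite /row_free eqn_leq rank_leq_row -{1}(eqP freeB) mxrankS.
have := (row_rp_seqP A).2 t' free'; rewrite leNgt => /negP; apply.
apply/ltxi_tuplePlt; exists k => [l lk|].
  by rewrite t'E (negPf (_ : l != k)) // -val_eqE neq_ltn lk.
by rewrite t'E eqxx.
Qed.

Lemma mem_row_rp i :
  (i \in row_rp A)
  = ~~ (row i A <= lead_submx (ltnW (ltn_ord i)) (leqnn n) A)%MS.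
Proof.
rewrite inE; apply/idP/idP => [/tnthP[k ik]|].
  (* Coordinate [k] vanishes on all rows above [i], hence on their span, but it is 1 on the selected
     row [i]. *)
  apply/negP=> /submxP[w wE]; have : U i k = 0.
    have -> : U i k = (row i A *m pinvmx B) 0 k by rewrite -row_mul [RHS]mxE.
    rewrite wE -mulmxA.
    have -> : lead_submx (ltnW (ltn_ord i)) (leqnn n) A *m pinvmx B
              = rowsub (widen_ord (ltnW (ltn_ord i))) U.
      apply/matrixP=> a b; rewrite !mxE; apply: eq_bigr => c _; rewrite mxE.
      by congr (A _ _ * _); apply: val_inj.
    rewrite mxE big1 // => a _; rewrite mxE coord_eq0 ?mulr0 //.
    by rewrite -/t -ik /=.
  have /rowP/(_ k) := coord_row_rp_seq k; rewrite -ik !mxE !eqxx => ->.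
  by move/eqP; rewrite oner_eq0.
(* A term with nonzero coefficient has selected index at most [i]; equality would make [i] selected,
   so that row lies strictly above. *)
apply: contraR => iNt; rewrite {1}AE row_mul mulmx_sum_row.
apply: summx_sub => k _; apply: contraNT iNt => Uik.
have lt_k : (tnth t k <= i)%N.
  rewrite leqNgt; apply: contra Uik => /coord_eq0 Uik0; rewrite mxE Uik0.
  by rewrite scale0r sub0mx.
move: lt_k; rewrite leq_eqVlt => /predU1P[/val_inj<-|lt_k]; first exact: mem_tnth.
case/negP: Uik; apply: scalemx_sub.
rewrite (_ : row k B = row (Ordinal lt_k)
           (lead_submx (ltnW (ltn_ord i)) (leqnn n) A)) ?row_sub //.
by apply/rowP=> b; rewrite !mxE; congr (A _ _); apply: val_inj.
Qed.

End RowRankProfile.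

(** * Comparison of row rank profiles with row supports *)

Lemma mem_row_supp (F : fieldType) m n (R : 'M[F]_(m, n)) i :
  col_partial_perm R ->
  (i \in row_supp R)
  = ~~ (row i R <= lead_submx (ltnW (ltn_ord i)) (leqnn n) R)%MS.
Proof.
move=> Rcol; apply/idP/idP => [/row_suppP[j Rij]|]; last first.
  by apply: contraR; rewrite inE negbK => /eqP->; apply: sub0mx.
(* Column [j] has its only nonzero entry in row [i], so every combination of the rows above is zero
   there. *)
apply/negP=> /submxP[w /rowP/(_ j)]; rewrite !mxE big1 => [/eqP|a _].
  exact/negP.
rewrite mxE (_ : widen_ord _ j = j); last exact: val_inj.
set a' := widen_ord _ a.
have [->|Raj] := eqVneq (R a' j) 0; first by rewrite mulr0.
by have /(congr1 val)/eqP := Rcol _ _ _ Raj Rij; rewrite /= (ltn_eqF (ltn_ord a)).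
Qed.

Lemma row_rp_row_supp (F : fieldType) m n (A R : 'M[F]_(m, n)) :
  col_partial_perm R ->
  (forall i (hi : (i <= m)%N), \rank (lead_submx hi (leqnn n) A)
                               = \rank (lead_submx hi (leqnn n) R)) ->
  row_rp A = row_supp R.
Proof.
move=> Rcol rkE; apply/setP=> i.
by rewrite mem_row_rp mem_row_supp // !row_sub_lead !rkE.
Qed.

Lemma col_partial_perm_lead (F : fieldType) m n (R : 'M[F]_(m, n)) i j
    (hi : (i <= m)%N) (hj : (j <= n)%N) :
  col_partial_perm R -> col_partial_perm (lead_submx hi hj R).
Proof.
move=> Rcol a a' b; rewrite !mxE => Rab Ra'b.
by apply/val_inj; have /(congr1 val) := Rcol _ _ _ Rab Ra'b.
Qed.

Lemma row_rp_lead (F : fieldType) m n (A R : 'M[F]_(m, n)) :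
  col_partial_perm R ->
  (forall i j (hi : (i <= m)%N) (hj : (j <= n)%N),
     \rank (lead_submx hi hj A) = \rank (lead_submx hi hj R)) ->
  forall i j (hi : (i <= m)%N) (hj : (j <= n)%N),
    row_rp (lead_submx hi hj A) = row_supp (lead_submx hi hj R).
Proof.
move=> Rcol rkE i j hi hj.
apply: row_rp_row_supp => [|i' hi']; first exact: col_partial_perm_lead.
by rewrite !lead_submx_lead.
Qed.

(** * Equality of leading ranks, invertibility and generic rank profile *)

Lemma lead_submx_full (T : Type) m n (M : 'M[T]_(m, n)) :
  lead_submx (leqnn m) (leqnn n) M = M.
Proof. by apply/matrixP=> a b; rewrite !mxE; congr (M _ _); apply: val_inj. Qed.

Lemma rank_lead_rank_profile_mx (F : fieldType) m n (A R : 'M[F]_(m, n)) i j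
    (hi : (i <= m)%N) (hj : (j <= n)%N) :
  is_rank_profile_mx A R ->
  \rank (lead_submx hi hj A) = \rank (lead_submx hi hj R).
Proof.
case/andP=> _ /forallP rkE.
(* An ordinal [i] in [is_rank_profile_mx] stands for size [i.+1], so empty submatrices are treated
   apart. *)
case: i hi => [|i] hi; first by rewrite !flatmx0 mxrank0.
case: j hj => [|j] hj; first by rewrite !thinmx0 mxrank0.
have /forallP/(_ (Ordinal hj))/eqP := rkE (Ordinal hi).
by rewrite !(lead_submx_irr (ltn_ord (Ordinal hi)) hi (ltn_ord (Ordinal hj)) hj).
Qed.

Lemma row_supp_free (F : fieldType) m n (M : 'M[F]_(m, n)) i :
  row_free M -> i \in row_supp M.
Proof.
move=> freeM; rewrite inE; apply/negP=> /eqP/(congr1 (mulmx^~ (pinvmx M))).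
rewrite -row_mul mulmxVp // mul0mx => /rowP/(_ i).
by rewrite !mxE eqxx => /eqP; rewrite oner_eq0.
Qed.

Lemma is_perm_mx_unit (F : fieldType) n (M : 'M[F]_n) r :
  is_sub_perm_mx r M -> is_perm_mx M = (M \in unitmx).
Proof.
move=> Msp; apply/idP/idP => [/is_perm_mxP[s ->]|]; first exact: unitmx_perm.
rewrite -row_free_unit => freeM.
(* Full rank gives each row a nonzero entry; uniqueness in columns makes this choice injective, and
   uniqueness in rows leaves no other entry. *)
have /fin_all_exists[f fP] i : exists j, M i j != 0.
  exact/row_suppP/row_supp_free.
have f_inj : injective f.
  by move=> i i' fE; apply: (sub_perm_col_uniq Msp (fP i)); rewrite fE.
apply/is_perm_mxP; exists (perm f_inj); apply/matrixP=> i j.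
rewrite !mxE permE; case/and3P: (Msp) => _ _ /forallP M1.
have /forallP/(_ j)/implyP Mij1 := M1 i.
have [fj|fj] := eqVneq; first by apply/eqP/Mij1; rewrite -fj.
apply/eqP/negPn/negP => Mij; case/eqP: fj.
by apply: (@sub_perm_row_uniq _ _ _ _ _ Msp _ _ i); rewrite mxE.
Qed.

Lemma lead_diag_generic (F : fieldType) m n (A R : 'M[F]_(m, n)) :
  is_rank_profile_mx A R -> is_lead_diag_mx R <-> generic_rank_profile A.
Proof.
move=> RA; have Rsp : is_sub_perm_mx (\rank A) R by case/andP: RA.
have rkR : \rank R = \rank A by case/and3P: Rsp => /eqP.
have detE k (hm : (k <= m)%N) (hn : (k <= n)%N) :
    (\det (lead_submx hm hn A) != 0) = row_free (lead_submx hm hn R).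
  by rewrite -unitfE -unitmxE -row_free_unit /row_free
             (rank_lead_rank_profile_mx _ _ RA).
split=> [[Rdiag Rlead] k hm hn /andP[_ kr]|genA].
  rewrite detE (_ : lead_submx hm hn R = 1%:M) ?row_free_unit ?unitmx1 //.
  apply/matrixP=> a b; rewrite !mxE.
  have [->|nab] := eqVneq a b.
    have := Rlead (widen_ord hm b) (widen_ord hn b) erefl.
    rewrite rkR /= (leq_trans (ltn_ord b) kr) => Rbb; apply/eqP.
    case/and3P: Rsp => _ _ /forallP/(_ (widen_ord hm b))/forallP.
    by move/(_ (widen_ord hn b))/implyP; apply.
  by apply/(is_diag_mxP Rdiag); rewrite /= val_eqE.
have rm : (\rank A <= m)%N by apply: rank_leq_row.
have rn : (\rank A <= n)%N by apply: rank_leq_col.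
(* Row [k] of the free leading block of size [k.+1] has a nonzero entry in some column [c <= k]. If
   [c < k], the nonzero diagonal entry given by induction lies in the same column, a
   contradiction. *)
have Rdiag k (a : 'I_m) (b : 'I_n) :
    (k < \rank A)%N -> a = k :> nat -> b = k :> nat -> R a b != 0.
  elim/ltn_ind: k a b => k IH a b kr ak bk.
  have := genA k.+1 (leq_trans kr rm) (leq_trans kr rn) kr.
  rewrite detE => freeR; have /row_suppP[c] := row_supp_free ord_max freeR.
  rewrite mxE (_ : widen_ord _ _ = a); last by apply: val_inj; rewrite /= ak.
  set c' := widen_ord _ c => Rac.
  have := ltn_ord c; rewrite ltnS leq_eqVlt => /predU1P[ck|ck].
    by rewrite (_ : b = c') //; apply: val_inj; rewrite /= bk ck.
  have cm : (c < m)%N by apply: ltn_trans ck _; rewrite -ak.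
  have Rcc : R (Ordinal cm) c' != 0
    by apply: (IH c) => //; exact: ltn_trans ck kr.
  have := sub_perm_col_uniq Rsp Rcc Rac => /(congr1 val) /= ca.
  by rewrite ca ak ltnn in ck.
pose diag (k : 'I_(\rank A)) := (widen_ord rm k, widen_ord rn k).
have diag_inj : injective diag by move=> k k' [kk' _]; apply: val_inj.
(* The first [\rank A] diagonal positions are as many as the nonzero entries, so they exhaust
   them. *)
have suppE : diag @: setT = [set ij | R ij.1 ij.2 != 0].
  apply/eqP; rewrite eqEcard; apply/andP; split.
    apply/subsetP=> _ /imsetP[k _ ->]; rewrite inE.
    exact: (Rdiag k).
  case/and3P: Rsp => _ /eqP-> _.
  by rewrite card_imset // cardsT card_ord.
have RP a b : R a b != 0 -> a = b :> nat /\ (a < \rank A)%N.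
  move=> Rab; have : (a, b) \in diag @: setT by rewrite suppE inE.
  by case/imsetP=> k _ [-> ->]; split=> //=; apply: ltn_ord.
split=> [|a b ab].
  apply/is_diag_mxP=> a b nab; apply/eqP/negPn/negP => /RP[ab _].
  by rewrite ab eqxx in nab.
rewrite rkR; apply/idP/idP => [/RP[]//|ar].
exact: (Rdiag a).
Qed.

Theorem lemma6 (F : fieldType) (m n : nat) (A : 'M[F]_(m, n)) :
  [/\ is_lead_diag_mx (rank_profile_mx A) <-> generic_rank_profile A,
      permutation_mx (rank_profile_mx A) <-> invertible_mx A,
      row_rp A = row_supp (rank_profile_mx A) /\
      col_rp A = col_supp (rank_profile_mx A)
    & forall (i j : nat) (hi : (i <= m)%N) (hj : (j <= n)%N),
        (1 <= i)%N -> (1 <= j)%N ->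
        row_rp (lead_submx hi hj A)
          = row_supp (lead_submx hi hj (rank_profile_mx A)) /\
        col_rp (lead_submx hi hj A)
          = col_supp (lead_submx hi hj (rank_profile_mx A))].
Proof.
move: (rank_profile_mx A) (rank_profile_mxP A) => R RA.
have Rsp : is_sub_perm_mx (\rank A) R by case/andP: RA.
have RP i j (hi : (i <= m)%N) (hj : (j <= n)%N) :
    row_rp (lead_submx hi hj A) = row_supp (lead_submx hi hj R) /\
    col_rp (lead_submx hi hj A) = col_supp (lead_submx hi hj R).
  split.
    apply: row_rp_lead => [|i' j' hi' hj']; first exact: sub_perm_col_uniq Rsp.
    exact: rank_lead_rank_profile_mx.
  rewrite /col_rp col_supp_tr !tr_lead_submx.
  apply: row_rp_lead => [|i' j' hi' hj']; first exact: sub_perm_row_uniq Rsp.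
  rewrite -!tr_lead_submx !mxrank_tr; exact: rank_lead_rank_profile_mx.
split=> //.
- exact: lead_diag_generic.
- have rkR : \rank R = \rank A by case/and3P: Rsp => /eqP.
  (* For a fixed [e] both matrices are square of the same rank, so one is invertible exactly when
     the other is. *)
  suff eqv (e : n = m) : is_perm_mx (castmx (erefl m, e) R)
                         = (castmx (erefl m, e) A \in unitmx).
    by split=> -[e]; rewrite ?eqv => He; exists e; rewrite ?eqv.
  subst m; rewrite !castmx_id (is_perm_mx_unit Rsp).
  by rewrite -!row_free_unit /row_free rkR.
(* The global profiles are the case of the full leading submatrix. *)
by have := RP _ _ (leqnn m) (leqnn n); rewrite !lead_submx_full.
Qed.
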